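(* Let $\theta^\infty_1,\theta^\infty_2\in\mathbb{C}$ with $\theta^\infty_1+\theta^\infty_2=0$. Let $q_1,p_1,q_2,p_2,u$ be holomorphic functions of $(t_1,t_2)$ on a domain of $\mathbb{C}^2$, with $u\neq0$. Put $G=\mathrm{diag}(1,u)$ and $$\hat A^{(-4)}=\begin{pmatrix}0&0\\0&1\end{pmatrix},\quad \hat A^{(-3)}=\begin{pmatrix}0&q_2\\-1&0\end{pmatrix},\quad \hat A^{(-2)}=\begin{pmatrix}-q_2&-p_1\\-q_1&q_2+2t_2\end{pmatrix},$$ $$\hat A^{(-1)}=\begin{pmatrix}p_1-q_1q_2&p_1q_1-(p_2-q_2-2t_2)q_2-\theta^\infty_1\\-p_2&-p_1+q_1q_2+t_1\end{pmatrix},\quad T=\begin{pmatrix}0&0\\0&-2t_2\end{pmatrix}.$$ Consider the linear systems $\frac{\partial Y}{\partial x}=AY$, $\frac{\partial Y}{\partial t_i}=B^{(i)}Y$ $(i=1,2)$ with $$A=G^{-1}\left(\hat A^{(-4)}x^3+\hat A^{(-3)}x^2+\hat A^{(-2)}x+\hat A^{(-1)}\right)G,$$ $$B^{(1)}=G^{-1}\left(\hat A^{(-4)}x+\hat A^{(-3)}\right)G,\quad B^{(2)}=G^{-1}\left(\hat A^{(-4)}x^2+\hat A^{(-3)}x+\hat A^{(-2)}+T\right)G .$$ Then the compatibility conditions $\partial_{t_i}A-\partial_xB^{(i)}+[A,B^{(i)}]=O$ for $i=1,2$ (for all $x$) are equivalent to the Hamiltonian system $$\frac{\partial q_j}{\partial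 t_i}=\frac{\partial H_{t_i}}{\partial p_j},\qquad \frac{\partial p_j}{\partial t_i}=-\frac{\partial H_{t_i}}{\partial q_j}\qquad(i,j=1,2),$$ $$H_{t_1}=-q_1(q_1p_1-\theta^\infty_1)+q_2\left(q_1(p_2+q_2)-2p_1+t_1\right)+p_1(p_2-2t_2),$$ $$H_{t_2}=H_{\mathrm{IV}}(-1,\theta^\infty_1;2t_2;q_2,p_2)+q_1q_2(q_1q_2-2p_1+t_1)+p_1(p_1-p_2q_1-t_1),$$ together with $$\frac1u\frac{\partial u}{\partial t_1}=-q_1,\qquad \frac1u\frac{\partial u}{\partial t_2}=2t_2-p_2 .$$
   Context: $H_{\mathrm{IV}}(\alpha,\beta;t;q,p)=pq(p-q-t)+\beta p+\alpha q$ is the Hamiltonian of the fourth Painlevé equation. The Hamiltonians are those of the degenerate Garnier system $H_{\mathrm{Gar}}^{5}$; the linear system has a single irregular singularity at $x=\infty$ of spectral type $((((1))))((((1))))$. *)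

(* Defs.v *)
From HB Require Import structures.
From mathcomp Require Import all_boot all_order all_algebra.
From mathcomp Require Import all_classical all_reals all_analysis.
From mathcomp Require Import complex.

Set Implicit Arguments.
Unset Strict Implicit.
Unset Printing Implicit Defensive.

Import Order.TTheory GRing.Theory Num.Theory.
Import numFieldNormedType.Exports.

Local Open Scope classical_set_scope.
Local Open Scope ring_scope.

(* Packing R[i] as a numClosedFieldType gives it the topological and normed
   structures of MathComp-Analysis, with the modulus as norm; derivatives over
   it are then complex derivatives. *)
Definition Cplx (R : realType) : numClosedFieldType := R[i].

Section GarnierDegenerate.
Variable R : realType.
Local Notation C := (Cplx R).

Definition domain (U : set (C * C)) : Prop := [/\ open U, connected U & U !=set0].

(* [differentiable] over the base field C: the differential is C-linear. *)
Definition holomorphic_on (U : set (C * C)) (f : C * C -> C) : Prop :=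
  forall t, U t -> differentiable f t.

(* For t = (t_1, t_2), 'D_dt1 and 'D_dt2 are the partial derivatives. *)
Definition dt1 : C * C := (1, 0).
Definition dt2 : C * C := (0, 1).

Definition mx2 (a b c d : C) : 'M[C]_2 :=
  \matrix_(i, j) if i == 0 then (if j == 0 then a else b)
                 else (if j == 0 then c else d).

Definition Ahat4 : 'M[C]_2 :=
  mx2 0 0
      0 1.

Definition Ahat3 (q2 : C) : 'M[C]_2 :=
  mx2 0    q2
      (-1) 0.

Definition Ahat2 (q1 p1 q2 t2 : C) : 'M[C]_2 :=
  mx2 (- q2) (- p1)
      (- q1) (q2 + 2 * t2).

Definition Ahat1 (th1 q1 p1 q2 p2 t1 t2 : C) : 'M[C]_2 :=
  mx2 (p1 - q1 * q2) (p1 * q1 - (p2 - q2 - 2 * t2) * q2 - th1)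
      (- p2)         (- p1 + q1 * q2 + t1).

Definition Tmx (t2 : C) : 'M[C]_2 :=
  mx2 0 0
      0 (- (2 * t2)).

Definition Gmx (u : C) : 'M[C]_2 :=
  mx2 1 0
      0 u.

Definition gauge (u : C) (M : 'M[C]_2) : 'M[C]_2 := invmx (Gmx u) *m M *m Gmx u.

Section LaxPair.
Variables (th1 : C) (q1 p1 q2 p2 u : C * C -> C).

Definition laxA (x : C) (t : C * C) : 'M[C]_2 :=
  gauge (u t) (x ^+ 3 *: Ahat4 + x ^+ 2 *: Ahat3 (q2 t)
    + x *: Ahat2 (q1 t) (p1 t) (q2 t) t.2
    + Ahat1 th1 (q1 t) (p1 t) (q2 t) (p2 t) t.1 t.2).

Definition laxB1 (x : C) (t : C * C) : 'M[C]_2 :=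
  gauge (u t) (x *: Ahat4 + Ahat3 (q2 t)).

Definition laxB2 (x : C) (t : C * C) : 'M[C]_2 :=
  gauge (u t) (x ^+ 2 *: Ahat4 + x *: Ahat3 (q2 t)
    + Ahat2 (q1 t) (p1 t) (q2 t) t.2 + Tmx t.2).

End LaxPair.

(* Compatibility at (x, t) of dY/dx = A Y and dY/dv = B Y, where v is the
   direction of differentiation in the space of t. *)
Definition compatible (A B : C -> C * C -> 'M[C]_2) (v : C * C)
    (x : C) (t : C * C) : Prop :=
  'D_v (A x) t - 'D_1 (fun y => B y t) x + (A x t *m B x t - B x t *m A x t) = 0.

Definition H_IV (alpha beta t q p : C) : C :=
  p * q * (p - q - t) + beta * p + alpha * q.

Definition Ham_t1 (th1 q1 p1 q2 p2 : C) (t : C * C) : C :=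
  - q1 * (q1 * p1 - th1) + q2 * (q1 * (p2 + q2) - 2 * p1 + t.1)
  + p1 * (p2 - 2 * t.2).

Definition Ham_t2 (th1 q1 p1 q2 p2 : C) (t : C * C) : C :=
  H_IV (-1) th1 (2 * t.2) q2 p2 + q1 * q2 * (q1 * q2 - 2 * p1 + t.1)
  + p1 * (p1 - p2 * q1 - t.1).

(* Hamilton's equations for the Hamiltonian H(q1, p1, q2, p2; t) in the
   direction v, at the point t. *)
Definition hamilton_eqs (H : C -> C -> C -> C -> C * C -> C) (v : C * C)
    (q1 p1 q2 p2 : C * C -> C) (t : C * C) : Prop :=
  [/\ 'D_v q1 t =   'D_1 (fun z : C => H (q1 t) z (q2 t) (p2 t) t) (p1 t),
      'D_v p1 t = - 'D_1 (fun z : C => H z (p1 t) (q2 t) (p2 t) t) (q1 t),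
      'D_v q2 t =   'D_1 (fun z : C => H (q1 t) (p1 t) (q2 t) z t) (p2 t) &
      'D_v p2 t = - 'D_1 (fun z : C => H (q1 t) (p1 t) z (p2 t) t) (q2 t)].

End GarnierDegenerate.

(* Main.v *)
Require Import Defs.
From HB Require Import structures.
From mathcomp Require Import all_boot all_order all_algebra.
From mathcomp Require Import all_classical all_reals all_analysis.
From mathcomp Require Import complex ring.
Import Order.TTheory GRing.Theory Num.Theory.
Import numFieldNormedType.Exports.
Local Open Scope classical_set_scope.
Local Open Scope ring_scope.

(** The gauge matrix [G = diag(1, u)] is removed first.  Since
    [D(G^-1 M G) = G^-1 (D M + [M, (D G) G^-1]) G] and
    [(D G) G^-1 = diag(0, w)] with [w = u^-1 D u], compatibility of the gauged
    pair amounts to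
      [D Ahat - d Bhat / dx + [Ahat, Bhat + diag(0, w)] = 0]
    for the ungauged matrices ([compatible_gauge]).

    The left-hand side is a matrix of polynomials in [x] whose coefficients are
    affine in the derivatives of [q1, p1, q2, p2] and in [w].  The
    leading terms cancel, leaving a first column of degree at most 2.  Requiring
    that this column vanish for all [x] gives five scalar equations in
    triangular form, whose unique solution is a system of evolution equations
    for [q1, p1, q2, p2] together with the value of [w]; with these values the
    second column vanishes identically as well ([zero_curvature1P],
    [zero_curvature2P]).  These evolution equations are Hamilton's equations,
    by computing the partial derivatives of the Hamiltonians
    ([hamilton_t1P], [hamilton_t2P]).

    Everything holds pointwise in [t]: at a point where the functions are
    complex differentiable and [u] does not vanish, compatibility for all [x]
    is equivalent to the differential equations at that point. *)

Set Implicit Arguments.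
Unset Strict Implicit.
Unset Printing Implicit Defensive.

(** * Directional derivatives *)

Section Derivatives.
Context {K : numFieldType} {V : normedModType K}.
Implicit Types (f g : V -> K) (t v : V).

(** The rules below are stated for functions written pointwise, so that the
    shape of a polynomial expression alone determines the rule to apply. *)
Lemma is_derive_fun_cst t v (c : K) : is_derive t v (fun _ => c) 0.
Proof. exact: is_derive_cst. Qed.

Lemma is_derive_funN t v f df :
  is_derive t v f df -> is_derive t v (fun s => - f s) (- df).
Proof. by move=> hf; exact: is_deriveN. Qed.

Lemma is_derive_funD t v f g df dg :
  is_derive t v f df -> is_derive t v g dg ->
  is_derive t v (fun s => f s + g s) (df + dg).
Proof. by move=> hf hg; exact: is_deriveD. Qed.

Lemma is_derive_funM t v f g df dg :
  is_derive t v f df -> is_derive t v g dg ->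
  is_derive t v (fun s => f s * g s) (f t * dg + g t * df).
Proof. by move=> hf hg; exact: is_deriveM. Qed.

Lemma is_derive_funV t v f df : f t != 0 ->
  is_derive t v f df -> is_derive t v (fun s => (f s)^-1) (- (f t) ^- 2 * df).
Proof.
move=> ft0 [hf <-]; apply: DeriveDef; first exact: derivableV.
by rewrite deriveV.
Qed.

Lemma is_derive_scalel (W : normedModType K) t v f df (w : W) :
  is_derive t v f df -> is_derive t v (fun s => f s *: w) (df *: w).
Proof.
move=> [/cvg_ex[l hl] hf].
have lE : df = l by rewrite -hf; exact: (cvg_lim _ hl).
have h : (fun h => h^-1 *: (((fun s => f s *: w) \o shift t) (h *: v) -
    f t *: w)) @ 0^' --> l *: w.
  rewrite (_ : (fun _ => _) =
    fun h => (h^-1 *: ((f \o shift t) (h *: v) - f t)) *: w); last first.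
    by apply/funext => h /=; rewrite -scalerA scalerBl.
  exact: cvgZr_tmp.
rewrite lE; apply: DeriveDef; first by apply/cvg_ex; exists (l *: w).
exact: (cvg_lim _ h).
Qed.

(** The matrix is the finite sum of its entries times the matrix units. *)
Lemma is_derive_mx m n (M : V -> 'M[K]_(m, n)) (dM : 'M[K]_(m, n)) t v :
  (forall i j, is_derive t v (fun s => M s i j) (dM i j)) ->
  is_derive t v M dM.
Proof.
move=> hM; rewrite [dM]matrix_sum_delta.
rewrite (_ : M = \sum_(i < m) \sum_(j < n) fun s => M s i j *: delta_mx i j).
  apply: is_derive_sum => i; apply: is_derive_sum => j.
  exact: is_derive_scalel.
apply/funext => s; rewrite {1}[M s]matrix_sum_delta fct_sumE.
by apply: eq_bigr => i _; rewrite fct_sumE.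
Qed.

(** Taking an entry is linear and continuous, so it commutes with the limit of
    difference quotients. *)
Lemma is_derive_entry m n (M : V -> 'M[K]_(m, n)) (dM : 'M[K]_(m, n)) t v i j :
  is_derive t v M dM -> is_derive t v (fun s => M s i j) (dM i j).
Proof.
move=> [/cvg_ex[l hl] hM].
have lE : dM = l by rewrite -hM; exact: (cvg_lim _ hl).
have h : (fun h => h^-1 *: (((fun s => M s i j) \o shift t) (h *: v) -
    M t i j)) @ 0^' --> l i j.
  rewrite (_ : (fun _ => _) = (fun N : 'M[K]_(m, n) => N i j) \o
    fun h => h^-1 *: ((M \o shift t) (h *: v) - M t)); last first.
    by apply/funext => h /=; rewrite !mxE.
  exact: (cvg_comp _ _ hl (@coord_continuous _ _ _ i j l)).
rewrite lE; apply: DeriveDef; first by apply/cvg_ex; exists (l i j).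
exact: (cvg_lim _ h).
Qed.

End Derivatives.

Lemma is_derive_fst (K : numFieldType) (t v : K * K) :
  is_derive t v (fun s => s.1) v.1.
Proof.
have c : continuous (fst : {linear (K * K)%type -> K}) by move=> s; exact: cvg_fst.
apply: DeriveDef; first exact/diff_derivable/linear_differentiable.
by rewrite deriveE ?diff_lin //; exact: linear_differentiable.
Qed.

Lemma is_derive_snd (K : numFieldType) (t v : K * K) :
  is_derive t v (fun s => s.2) v.2.
Proof.
have c : continuous (snd : {linear (K * K)%type -> K}) by move=> s; exact: cvg_snd.
apply: DeriveDef; first exact/diff_derivable/linear_differentiable.
by rewrite deriveE ?diff_lin //; exact: linear_differentiable.
Qed.

(** [is_derive] being a class, an ordinary [refine] would search for the premises
    by instance resolution, which is prohibitively slow on polynomials with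
    several factors; here the head symbol selects the rule. *)
Ltac derive_poly :=
  first [ eassumption
        | notypeclasses refine (is_derive_id _ _)
        | notypeclasses refine (is_derive_fun_cst _ _ _)
        | notypeclasses refine (is_derive_funN _); derive_poly
        | notypeclasses refine (is_derive_funD _ _); derive_poly
        | notypeclasses refine (is_derive_funM _ _); derive_poly ].

Ltac derive_ring :=
  notypeclasses refine (@is_derive_eq _ _ _ _ _ _ _ _ _ _);
  [derive_poly | rewrite /=; ring].

(** * Two-by-two matrices and the gauge action *)

Section Mx2.
Variable R : realType.
Local Notation C := (Cplx R).

Lemma ord2P (i : 'I_2) : i = 0 \/ i = 1.
Proof.
by case: i => -[|[|//]] i; [left|right]; apply: val_inj.
Qed.

Lemma mx2_entries (M : 'M[C]_2) : M = mx2 (M 0 0) (M 0 1) (M 1 0) (M 1 1).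
Proof.
apply/matrixP => i j; rewrite mxE.
by case: (ord2P i) => ->; case: (ord2P j) => ->.
Qed.

Lemma mx2D (a b c d a' b' c' d' : C) :
  mx2 a b c d + mx2 a' b' c' d' = mx2 (a + a') (b + b') (c + c') (d + d').
Proof. by apply/matrixP => i j; rewrite !mxE; do 2 case: ifP. Qed.

Lemma mx2N (a b c d : C) : - mx2 a b c d = mx2 (- a) (- b) (- c) (- d).
Proof. by apply/matrixP => i j; rewrite !mxE; do 2 case: ifP. Qed.

Lemma mx2Z (k a b c d : C) :
  k *: mx2 a b c d = mx2 (k * a) (k * b) (k * c) (k * d).
Proof. by apply/matrixP => i j; rewrite !mxE; do 2 case: ifP. Qed.

Lemma mx2M (a b c d a' b' c' d' : C) :
  mx2 a b c d *m mx2 a' b' c' d' =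
  mx2 (a * a' + b * c') (a * b' + b * d') (c * a' + d * c') (c * b' + d * d').
Proof.
apply/matrixP => i j; rewrite !mxE !big_ord_recl big_ord0 addr0 !mxE.
by do 2 case: ifP.
Qed.

Lemma mx2_eq0 (a b c d : C) :
  mx2 a b c d = 0 <-> [/\ a = 0, b = 0, c = 0 & d = 0].
Proof.
split=> [/matrixP h|[-> -> -> ->]].
  by split; [have := h 0 0|have := h 0 1|have := h 1 0|have := h 1 1]; rewrite !mxE.
by apply/matrixP => i j; rewrite !mxE; do 2 case: ifP.
Qed.

Definition mx2E := (mx2Z, mx2M, mx2N, mx2D).

Lemma is_derive_mx2 (V : normedModType C) (a b c d : V -> C)
    (da db dc dd : C) t v :
  is_derive t v a da -> is_derive t v b db -> is_derive t v c dc ->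
  is_derive t v d dd ->
  is_derive t v (fun s => mx2 (a s) (b s) (c s) (d s)) (mx2 da db dc dd).
Proof.
move=> ha hb hc hd; apply: is_derive_mx => i j; rewrite !mxE.
rewrite (_ : (fun _ => _) = if i == 0 then if j == 0 then a else b
  else if j == 0 then c else d); first by do 2 case: ifP.
by apply/funext => s; rewrite mxE; do 2 case: ifP.
Qed.

Lemma mul_Gmx_inv (u : C) : u != 0 -> mx2 1 0 0 u^-1 *m Gmx u = 1%:M.
Proof.
move=> u0; rewrite mx2M [RHS]mx2_entries !mxE /=.
by congr mx2; rewrite ?mulr1n ?mulr0n; field.
Qed.

Lemma Gmx_unit (u : C) : u != 0 -> Gmx u \in unitmx.
Proof. by move=> /mul_Gmx_inv /mulmx1_unit[]. Qed.

Lemma gaugeE (u a b c d : C) : u != 0 ->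
  gauge u (mx2 a b c d) = mx2 a (b * u) (u^-1 * c) d.
Proof.
move=> u0; have -> M : gauge u M = mx2 1 0 0 u^-1 *m M *m Gmx u.
  by rewrite -[mx2 1 0 0 _](mulmxK (Gmx_unit u0)) mul_Gmx_inv // mul1mx.
by rewrite !mx2M; congr mx2; field.
Qed.

Lemma gaugeD (u : C) (M N : 'M[C]_2) : gauge u (M + N) = gauge u M + gauge u N.
Proof. by rewrite /gauge mulmxDr mulmxDl. Qed.

Lemma gaugeN (u : C) (M : 'M[C]_2) : gauge u (- M) = - gauge u M.
Proof. by rewrite /gauge mulmxN mulNmx. Qed.

Lemma gaugeM (u : C) (M N : 'M[C]_2) : u != 0 ->
  gauge u (M *m N) = gauge u M *m gauge u N.
Proof.
by move=> /Gmx_unit Gu; rewrite /gauge !mulmxA mulmxK.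
Qed.

Lemma gauge_eq0 (u : C) (M : 'M[C]_2) : u != 0 -> gauge u M = 0 <-> M = 0.
Proof.
move=> /Gmx_unit Gu; split=> [h|->]; last by rewrite /gauge mulmx0 mul0mx.
have -> : M = Gmx u *m gauge u M *m invmx (Gmx u).
  by rewrite /gauge !mulmxA mulmxV // mul1mx mulmxK.
by rewrite h mulmx0 mul0mx.
Qed.

End Mx2.

(** * Removing the gauge from the compatibility condition *)

Section Gauge.
Variable R : realType.
Local Notation C := (Cplx R).

Definition comm_mx2 (M N : 'M[C]_2) : 'M[C]_2 := M *m N - N *m M.

Lemma comm_mx2D (M N P : 'M[C]_2) :
  comm_mx2 M (N + P) = comm_mx2 M N + comm_mx2 M P.
Proof. by rewrite /comm_mx2 mulmxDr mulmxDl opprD addrACA. Qed.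

Lemma gauge_comm (u : C) (M N : 'M[C]_2) : u != 0 ->
  gauge u (comm_mx2 M N) = comm_mx2 (gauge u M) (gauge u N).
Proof. by move=> u0; rewrite /comm_mx2 gaugeD gaugeN !gaugeM. Qed.

(** Differentiating [G^-1 M G] adds to [D M] the commutator of [M] with
    [(D G) G^-1 = diag(0, u^-1 D u)].  As [gauge] uses a matrix inverse that is
    given by a formula only where [u] is nonzero, continuity of [u] is needed to
    have that formula in a neighborhood of [t]. *)
Lemma is_derive_gauge (V : normedModType C) (u : V -> C) (M : V -> 'M[C]_2)
    (dM : 'M[C]_2) t v :
  differentiable u t -> u t != 0 -> is_derive t v M dM ->
  is_derive t v (fun s => gauge (u s) (M s))
    (gauge (u t) (dM + comm_mx2 (M t) (mx2 0 0 0 ((u t)^-1 * 'D_v u t)))).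
Proof.
move=> du u0 hM.
have near_u0 : \forall s \near t, u s != 0.
  exact: (cvgr_neq0 (u t) (differentiable_continuous du) u0).
have hu : is_derive t v u ('D_v u t) by exact/derivableP/diff_derivable.
have h i j := is_derive_entry i j hM.
apply: (@near_eq_is_derive _ V ('M[C]_2)
  (fun s => mx2 (M s 0 0) (M s 0 1 * u s) ((u s)^-1 * M s 1 0) (M s 1 1))).
  by near=> s; rewrite [M s]mx2_entries gaugeE ?mxE //; near: s.
have -> : gauge (u t) (dM + comm_mx2 (M t) (mx2 0 0 0 ((u t)^-1 * 'D_v u t))) =
    mx2 (dM 0 0) (M t 0 1 * 'D_v u t + u t * dM 0 1)
      ((u t)^-1 * dM 1 0 + M t 1 0 * (- (u t) ^- 2 * 'D_v u t)) (dM 1 1).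
  rewrite [dM in LHS]mx2_entries [M t in LHS]mx2_entries /comm_mx2 !mx2E.
  by rewrite gaugeE //; congr mx2; field.
exact: (is_derive_mx2 (h 0 0) (is_derive_funM (h 0 1) hu)
  (is_derive_funM (is_derive_funV u0 hu) (h 1 0)) (h 1 1)).
Unshelve. all: by end_near. Qed.

Lemma is_derive_gauge_cst (V : normedModType C) (u : C) (N : V -> 'M[C]_2)
    (dN : 'M[C]_2) t v :
  u != 0 -> is_derive t v N dN ->
  is_derive t v (fun s => gauge u (N s)) (gauge u dN).
Proof.
move=> u0 hN; have := @is_derive_gauge V (fun _ => u) N dN t v.
rewrite derive_cst mulr0 (_ : mx2 0 0 0 0 = 0); last exact/mx2_eq0.
by rewrite /comm_mx2 mulmx0 mul0mx subrr addr0; apply.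
Qed.

(** Conjugation by [G] preserves commutators and is injective, so it drops out
    once the derivative of the gauged matrix is known; the logarithmic
    derivative of [u] is then absorbed into [N]. *)
Lemma compatible_gauge (u : C * C -> C) (M N : C -> C * C -> 'M[C]_2)
    (dM dN : 'M[C]_2) (v : C * C) (x : C) (t : C * C) :
  differentiable u t -> u t != 0 ->
  is_derive t v (M x) dM -> is_derive x 1 (fun y => N y t) dN ->
  compatible (fun y s => gauge (u s) (M y s)) (fun y s => gauge (u s) (N y s))
    v x t <->
  dM - dN + comm_mx2 (M x t) (N x t + mx2 0 0 0 ((u t)^-1 * 'D_v u t)) = 0.
Proof.
move=> du u0 hM hN.
have [_ dgM] := is_derive_gauge du u0 hM.
have [_ dgN] := is_derive_gauge_cst u0 hN.
rewrite /compatible [X in X - _](dgM : _ = _) [X in _ - X](dgN : _ = _).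
rewrite -/(comm_mx2 _ _) -gauge_comm // -gaugeN -!gaugeD gauge_eq0 // comm_mx2D.
move: (comm_mx2 _ (N x t)) (comm_mx2 _ (mx2 _ _ _ _)) => P Q.
by rewrite [dM + Q - dN]addrAC [P + Q]addrC addrA.
Qed.

End Gauge.

(** * The zero-curvature equations *)

Section LaxPair.
Variable R : realType.
Local Notation C := (Cplx R).

(** The values at 0, 1 and -1 already determine the coefficients. *)
Lemma quadratic_coef_eq0 (c0 c1 c2 : C) :
  (forall x, c0 + c1 * x + c2 * x ^+ 2 = 0) -> [/\ c0 = 0, c1 = 0 & c2 = 0].
Proof.
move=> h; have h0 : c0 = 0 by rewrite -(h 0); ring.
have two0 : 2 != 0 :> C by rewrite pnatr_eq0.
split=> //; apply: (mulfI two0); rewrite mulr0.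
  transitivity ((c0 + c1 * 1 + c2 * 1 ^+ 2) - (c0 + c1 * -1 + c2 * (-1) ^+ 2)).
    by ring.
  by rewrite !h subr0.
transitivity ((c0 + c1 * 1 + c2 * 1 ^+ 2) + (c0 + c1 * -1 + c2 * (-1) ^+ 2) - 2 * c0).
  by ring.
by rewrite !h h0; ring.
Qed.

Definition hatA (th1 q1 p1 q2 p2 t1 t2 x : C) : 'M[C]_2 :=
  mx2 (p1 - q1 * q2 - q2 * x)
      (q2 * x ^+ 2 - p1 * x + (p1 * q1 - (p2 - q2 - 2 * t2) * q2 - th1))
      (- x ^+ 2 - q1 * x - p2)
      (x ^+ 3 + (q2 + 2 * t2) * x + (- p1 + q1 * q2 + t1)).

(** The total derivative of [hatA] in a direction [(dt1, dt2)] along which the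
    functions [q1, p1, q2, p2] have derivatives [dq1, dp1, dq2, dp2]. *)
Definition dhatA (q1 p1 q2 p2 t2 dq1 dp1 dq2 dp2 dt1 dt2 x : C) : 'M[C]_2 :=
  mx2 (dp1 - (q1 * dq2 + q2 * dq1) - dq2 * x)
      (dq2 * x ^+ 2 - dp1 * x + (p1 * dq1 + q1 * dp1
        - ((p2 - q2 - 2 * t2) * dq2 + q2 * (dp2 - dq2 - 2 * dt2))))
      (- dq1 * x - dp2)
      ((dq2 + 2 * dt2) * x + (- dp1 + (q1 * dq2 + q2 * dq1) + dt1)).

Definition hatB1 (q2 x : C) : 'M[C]_2 := mx2 0 q2 (-1) x.

Definition hatB2 (q1 p1 q2 x : C) : 'M[C]_2 :=
  mx2 (- q2) (q2 * x - p1) (- x - q1) (x ^+ 2 + q2).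

(** The compatibility condition freed of the gauge, with [w] in place of the
    logarithmic derivative of [u] in the direction considered; the subtracted
    matrix is the [x]-derivative of the second matrix of the pair. *)
Definition zero_curvature1 (th1 q1 p1 q2 p2 t1 t2 dq1 dp1 dq2 dp2 w x : C) :
    'M[C]_2 :=
  dhatA q1 p1 q2 p2 t2 dq1 dp1 dq2 dp2 1 0 x - mx2 0 0 0 1 +
  comm_mx2 (hatA th1 q1 p1 q2 p2 t1 t2 x) (hatB1 q2 x + mx2 0 0 0 w).

Definition zero_curvature2 (th1 q1 p1 q2 p2 t1 t2 dq1 dp1 dq2 dp2 w x : C) :
    'M[C]_2 :=
  dhatA q1 p1 q2 p2 t2 dq1 dp1 dq2 dp2 0 1 x - mx2 0 q2 (-1) (2 * x) +
  comm_mx2 (hatA th1 q1 p1 q2 p2 t1 t2 x) (hatB2 q1 p1 q2 x + mx2 0 0 0 w).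

(** Necessity uses the first column only.  The coefficient of [x^2] in the lower
    left entry gives [w], then that of [x] gives [dq1] and the constant term
    gives [dp2]; in the upper left entry the coefficient of [x] gives [dq2], and
    the constant term, a relation between [dp1], [dq1] and [dq2], gives [dp1]. *)
Lemma zero_curvature1P (th1 q1 p1 q2 p2 t1 t2 dq1 dp1 dq2 dp2 w : C) :
  (forall x, zero_curvature1 th1 q1 p1 q2 p2 t1 t2 dq1 dp1 dq2 dp2 w x = 0) <->
  [/\ dq1 = - q1 ^+ 2 - 2 * q2 + p2 - 2 * t2,
      dp1 = 2 * q1 * p1 - th1 - q2 * (p2 + q2),
      dq2 = q1 * q2 + p1,
      dp2 = - (q1 * p2 + 2 * q1 * q2 - 2 * p1 + t1) & w = - q1].
Proof.
rewrite /zero_curvature1 /comm_mx2 /dhatA /hatA /hatB1; split=> [h|[-> -> -> -> ->] x].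
  (* the coefficients of 1, x and x^2 in the upper left entry *)
  have [|/subr0_eq e0 /subr0_eq dq2E _] := @quadratic_coef_eq0
    (dp1 - (q1 * dq2 + q2 * dq1 + p1 * q1 - (2 * p2 - q2 - 2 * t2) * q2 - th1))
    (q1 * q2 + p1 - dq2) 0.
    by move=> x; move: (h x); rewrite !mx2E => /mx2_eq0[e _ _ _]; rewrite -[RHS]e; ring.
  (* the coefficients of 1, x and x^2 in the lower left entry *)
  have [|/subr0_eq dp2E /subr0_eq dq1E /subr0_eq wE] := @quadratic_coef_eq0
    (2 * p1 - 2 * q1 * q2 - t1 + w * p2 - dp2)
    (p2 - 2 * q2 - 2 * t2 + w * q1 - dq1) (w - - q1).
    by move=> x; move: (h x); rewrite !mx2E => /mx2_eq0[_ _ e _]; rewrite -[RHS]e; ring.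
  by split=> //; rewrite ?e0 -?dp2E -?dq2E -?dq1E ?wE; ring.
by rewrite !mx2E; apply/mx2_eq0; split; ring.
Qed.

(** The five equations come from the same coefficients of the first column as
    in the previous lemma. *)
Lemma zero_curvature2P (th1 q1 p1 q2 p2 t1 t2 dq1 dp1 dq2 dp2 w : C) :
  (forall x, zero_curvature2 th1 q1 p1 q2 p2 t1 t2 dq1 dp1 dq2 dp2 w x = 0) <->
  [/\ dq1 = 2 * p1 - 2 * q1 * q2 - t1 - p2 * q1,
      dp1 = q2 * (2 * p1 - 2 * q1 * q2 - t1) + p1 * p2,
      dq2 = 2 * p2 * q2 - q2 ^+ 2 - 2 * t2 * q2 + th1 - p1 * q1,
      dp2 = 1 + q1 * (2 * p1 - 2 * q1 * q2 - t1) + 2 * p2 * q2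
            + 2 * t2 * p2 - p2 ^+ 2 & w = 2 * t2 - p2].
Proof.
rewrite /zero_curvature2 /comm_mx2 /dhatA /hatA /hatB2; split=> [h|[-> -> -> -> ->] x].
  (* the coefficients of 1, x and x^2 in the upper left entry *)
  have [|/subr0_eq e0 /subr0_eq dq2E _] := @quadratic_coef_eq0
    (dp1 - (q1 * dq2 + q2 * dq1
            + q1 * (p1 * q1 - (p2 - q2 - 2 * t2) * q2 - th1) + p1 * p2))
    (q2 * p2 - (p1 * q1 - (p2 - q2 - 2 * t2) * q2 - th1) - dq2) 0.
    by move=> x; move: (h x); rewrite !mx2E => /mx2_eq0[e _ _ _]; rewrite -[RHS]e; ring.
  (* the coefficients of 1, x and x^2 in the lower left entry *)
  have [|/subr0_eq dp2E /subr0_eq dq1E /subr0_eq wE] := @quadratic_coef_eq0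
    (1 + q1 * (2 * p1 - 2 * q1 * q2 - t1) + 2 * p2 * q2 + w * p2 - dp2)
    (2 * p1 - 2 * q1 * q2 - t1 - 2 * t2 * q1 + w * q1 - dq1)
    (w - (2 * t2 - p2)).
    by move=> x; move: (h x); rewrite !mx2E => /mx2_eq0[_ _ e _]; rewrite -[RHS]e; ring.
  by split=> //; rewrite ?e0 -?dp2E -?dq2E -?dq1E ?wE; ring.
by rewrite !mx2E; apply/mx2_eq0; split; ring.
Qed.

End LaxPair.

(** * The Lax pair along holomorphic functions *)

Section Functions.
Variable R : realType.
Local Notation C := (Cplx R).
Variables (th1 : C) (q1 p1 q2 p2 u : C * C -> C).

Lemma laxAE : laxA th1 q1 p1 q2 p2 u = fun x s =>
  gauge (u s) (hatA th1 (q1 s) (p1 s) (q2 s) (p2 s) s.1 s.2 x).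
Proof.
apply/funext => x; apply/funext => s; congr gauge.
by rewrite /hatA !mx2E; congr mx2; ring.
Qed.

Lemma laxB1E : laxB1 q2 u = fun x s => gauge (u s) (hatB1 (q2 s) x).
Proof.
apply/funext => x; apply/funext => s; congr gauge.
by rewrite /hatB1 !mx2E; congr mx2; ring.
Qed.

Lemma laxB2E : laxB2 q1 p1 q2 u = fun x s =>
  gauge (u s) (hatB2 (q1 s) (p1 s) (q2 s) x).
Proof.
apply/funext => x; apply/funext => s; congr gauge.
by rewrite /hatB2 !mx2E; congr mx2; ring.
Qed.

Lemma is_derive_hatA (t v : C * C) (dq1 dp1 dq2 dp2 x : C) :
  is_derive t v q1 dq1 -> is_derive t v p1 dp1 ->
  is_derive t v q2 dq2 -> is_derive t v p2 dp2 ->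
  is_derive t v (fun s => hatA th1 (q1 s) (p1 s) (q2 s) (p2 s) s.1 s.2 x)
    (dhatA (q1 t) (p1 t) (q2 t) (p2 t) t.2 dq1 dp1 dq2 dp2 v.1 v.2 x).
Proof.
move=> hq1 hp1 hq2 hp2.
have ht1 := is_derive_fst t v; have ht2 := is_derive_snd t v.
notypeclasses refine (is_derive_mx2 _ _ _ _); derive_ring.
Qed.

Lemma is_derive_hatB1 (q' x : C) : is_derive x 1 (hatB1 q') (mx2 0 0 0 1).
Proof. notypeclasses refine (is_derive_mx2 _ _ _ _); derive_ring. Qed.

Lemma is_derive_hatB2 (q p q' x : C) :
  is_derive x 1 (hatB2 q p q') (mx2 0 q' (-1) (2 * x)).
Proof.
notypeclasses refine (is_derive_mx2 _ _ _ _); derive_ring.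
Qed.

Variable t : C * C.
Hypotheses (hq1 : differentiable q1 t) (hp1 : differentiable p1 t).
Hypotheses (hq2 : differentiable q2 t) (hp2 : differentiable p2 t).
Hypotheses (hu : differentiable u t) (u0 : u t != 0).

Lemma compatible1P x :
  compatible (laxA th1 q1 p1 q2 p2 u) (laxB1 q2 u) (dt1 R) x t <->
  zero_curvature1 th1 (q1 t) (p1 t) (q2 t) (p2 t) t.1 t.2 ('D_(dt1 R) q1 t)
    ('D_(dt1 R) p1 t) ('D_(dt1 R) q2 t) ('D_(dt1 R) p2 t)
    ((u t)^-1 * 'D_(dt1 R) u t) x = 0.
Proof.
rewrite laxAE laxB1E; apply: compatible_gauge => //; last exact: is_derive_hatB1.
by apply: is_derive_hatA; exact/derivableP/diff_derivable.
Qed.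

Lemma compatible2P x :
  compatible (laxA th1 q1 p1 q2 p2 u) (laxB2 q1 p1 q2 u) (dt2 R) x t <->
  zero_curvature2 th1 (q1 t) (p1 t) (q2 t) (p2 t) t.1 t.2 ('D_(dt2 R) q1 t)
    ('D_(dt2 R) p1 t) ('D_(dt2 R) q2 t) ('D_(dt2 R) p2 t)
    ((u t)^-1 * 'D_(dt2 R) u t) x = 0.
Proof.
rewrite laxAE laxB2E; apply: compatible_gauge => //; last exact: is_derive_hatB2.
by apply: is_derive_hatA; exact/derivableP/diff_derivable.
Qed.

End Functions.

(** * Hamilton's equations in explicit form *)

Section Hamiltonians.
Variable R : realType.
Local Notation C := (Cplx R).
Variables (th1 : C) (q1 p1 q2 p2 : C * C -> C).

Lemma hamilton_t1P v t : hamilton_eqs (Ham_t1 th1) v q1 p1 q2 p2 t <->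
  [/\ 'D_v q1 t = - q1 t ^+ 2 - 2 * q2 t + p2 t - 2 * t.2,
      'D_v p1 t = 2 * q1 t * p1 t - th1 - q2 t * (p2 t + q2 t),
      'D_v q2 t = q1 t * q2 t + p1 t &
      'D_v p2 t = - (q1 t * p2 t + 2 * q1 t * q2 t - 2 * p1 t + t.1)].
Proof.
rewrite /hamilton_eqs /Ham_t1.
set dHp1 := 'D_1 _ (p1 t); set dHq1 := 'D_1 _ (q1 t).
set dHp2 := 'D_1 _ (p2 t); set dHq2 := 'D_1 _ (q2 t).
have -> : dHp1 = - q1 t ^+ 2 - 2 * q2 t + p2 t - 2 * t.2.
  by notypeclasses refine (@derive_val _ _ _ _ _ _ _ _); derive_ring.
have -> : dHq1 = - (2 * q1 t * p1 t - th1 - q2 t * (p2 t + q2 t)).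
  by notypeclasses refine (@derive_val _ _ _ _ _ _ _ _); derive_ring.
have -> : dHp2 = q1 t * q2 t + p1 t.
  by notypeclasses refine (@derive_val _ _ _ _ _ _ _ _); derive_ring.
have -> : dHq2 = q1 t * p2 t + 2 * q1 t * q2 t - 2 * p1 t + t.1.
  by notypeclasses refine (@derive_val _ _ _ _ _ _ _ _); derive_ring.
by rewrite opprK.
Qed.

Lemma hamilton_t2P v t : hamilton_eqs (Ham_t2 th1) v q1 p1 q2 p2 t <->
  [/\ 'D_v q1 t = 2 * p1 t - 2 * q1 t * q2 t - t.1 - p2 t * q1 t,
      'D_v p1 t = q2 t * (2 * p1 t - 2 * q1 t * q2 t - t.1) + p1 t * p2 t,
      'D_v q2 t = 2 * p2 t * q2 t - q2 t ^+ 2 - 2 * t.2 * q2 t + th1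
                  - p1 t * q1 t &
      'D_v p2 t = 1 + q1 t * (2 * p1 t - 2 * q1 t * q2 t - t.1)
                  + 2 * p2 t * q2 t + 2 * t.2 * p2 t - p2 t ^+ 2].
Proof.
rewrite /hamilton_eqs /Ham_t2 /H_IV.
set dHp1 := 'D_1 _ (p1 t); set dHq1 := 'D_1 _ (q1 t).
set dHp2 := 'D_1 _ (p2 t); set dHq2 := 'D_1 _ (q2 t).
have -> : dHp1 = 2 * p1 t - 2 * q1 t * q2 t - t.1 - p2 t * q1 t.
  by notypeclasses refine (@derive_val _ _ _ _ _ _ _ _); derive_ring.
have -> : dHq1 = - (q2 t * (2 * p1 t - 2 * q1 t * q2 t - t.1) + p1 t * p2 t).
  by notypeclasses refine (@derive_val _ _ _ _ _ _ _ _); derive_ring.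
have -> : dHp2 = 2 * p2 t * q2 t - q2 t ^+ 2 - 2 * t.2 * q2 t + th1 - p1 t * q1 t.
  by notypeclasses refine (@derive_val _ _ _ _ _ _ _ _); derive_ring.
have -> : dHq2 = - (1 + q1 t * (2 * p1 t - 2 * q1 t * q2 t - t.1)
                  + 2 * p2 t * q2 t + 2 * t.2 * p2 t - p2 t ^+ 2).
  by notypeclasses refine (@derive_val _ _ _ _ _ _ _ _); derive_ring.
by rewrite !opprK.
Qed.
End Hamiltonians.

(** * The equivalence *)

Theorem mainTheorem15 (R : realType) (th1 th2 : Cplx R)
    (U : set (Cplx R * Cplx R)%type)
    (q1 p1 q2 p2 u : (Cplx R * Cplx R)%type -> Cplx R)
    (hth : th1 + th2 = 0)
    (hU : domain U)
    (hq1 : holomorphic_on U q1) (hp1 : holomorphic_on U p1)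
    (hq2 : holomorphic_on U q2) (hp2 : holomorphic_on U p2)
    (hu : holomorphic_on U u) (hu0 : forall t, U t -> u t != 0) :
  let A := laxA th1 q1 p1 q2 p2 u in
  let B1 := laxB1 q2 u in
  let B2 := laxB2 q1 p1 q2 u in
  (forall t, U t -> forall x : Cplx R,
     compatible A B1 (dt1 R) x t /\ compatible A B2 (dt2 R) x t)
  <->
  (forall t, U t ->
     [/\ hamilton_eqs (Ham_t1 th1) (dt1 R) q1 p1 q2 p2 t,
         hamilton_eqs (Ham_t2 th1) (dt2 R) q1 p1 q2 p2 t,
         (u t)^-1 * 'D_(dt1 R) u t = - q1 t &
         (u t)^-1 * 'D_(dt2 R) u t = 2 * t.2 - p2 t]).
Proof.
move=> A B1 B2; split=> h t Ut.
  have [q1_1 p1_1 q2_1 p2_1 u_1] :=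
    (zero_curvature1P _ _ _ _ _ _ _ _ _ _ _ _).1 (fun x =>
      (compatible1P th1 (hq1 t Ut) (hp1 t Ut) (hq2 t Ut) (hp2 t Ut)
        (hu t Ut) (hu0 t Ut) x).1 (h t Ut x).1).
  have [q1_2 p1_2 q2_2 p2_2 u_2] :=
    (zero_curvature2P _ _ _ _ _ _ _ _ _ _ _ _).1 (fun x =>
      (compatible2P th1 (hq1 t Ut) (hp1 t Ut) (hq2 t Ut) (hp2 t Ut)
        (hu t Ut) (hu0 t Ut) x).1 (h t Ut x).2).
  by split; [apply/hamilton_t1P; split|apply/hamilton_t2P; split|exact: u_1|
             exact: u_2].
move=> x; have [/hamilton_t1P[q1_1 p1_1 q2_1 p2_1]] := h t Ut.
move=> /hamilton_t2P[q1_2 p1_2 q2_2 p2_2] u_1 u_2; split.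
  apply/(compatible1P th1 (hq1 t Ut) (hp1 t Ut) (hq2 t Ut) (hp2 t Ut)
    (hu t Ut) (hu0 t Ut)).
  by move: x; apply/zero_curvature1P; split.
apply/(compatible2P th1 (hq1 t Ut) (hp1 t Ut) (hq2 t Ut) (hp2 t Ut)
  (hu t Ut) (hu0 t Ut)).
by move: x; apply/zero_curvature2P; split.
Qed.
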